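(* Let $m,n\ge1$ be integers. The number of monic $n$-smooth polynomials of degree $m$ over $\mathbb{F}_q$ is $$q^{m}\sum_{(j_{n+1},\dots,j_m)}\mathbf{1}\Big[\sum_{i=n+1}^m ij_i\le m\Big]\prod_{i=n+1}^m q^{-ij_i}\binom{|I_i|}{j_i}(-1)^{j_i},$$ where the sum runs over all tuples of integers with $0\le j_i\le|I_i|$ for $n+1\le i\le m$.
   Context: $\mathbb{F}_q$ is a finite field with $q$ elements; $I_i$ is the set of monic irreducible polynomials of degree $i$ over $\mathbb{F}_q$. A polynomial is $n$-smooth if all its irreducible factors have degree at most $n$. $\mathbf{1}[P]$ is $1$ if $P$ is true and $0$ otherwise. *)

(* Defs.v *)
From mathcomp Require Import all_boot all_order all_algebra.
From mathcomp Require Import boolp.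

Set Implicit Arguments.
Unset Strict Implicit.
Unset Printing Implicit Defensive.

Import Order.TTheory GRing.Theory Num.Theory.
Local Open Scope ring_scope.

(* A polynomial of degree d has size d.+1, so it lives in the finite type
   {poly_d.+1 F} of polynomials of size at most d.+1. *)
Definition monic_irr (F : finFieldType) (i : nat) : {set {poly_i.+1 F}} :=
  [set p : {poly_i.+1 F} |
    [&& polyn p \is monic, size (polyn p) == i.+1 & irreducibleb (polyn p)]].

(* [size f <= n.+1] says deg f <= n, as irreducible polynomials are nonzero. *)
Definition smooth (F : fieldType) (n : nat) (p : {poly F}) : Prop :=
  forall f : {poly F}, irreducible_poly f -> f %| p -> (size f <= n.+1)%N.

Definition monic_smooth (F : finFieldType) (n m : nat) : {set {poly_m.+1 F}} :=
  [set p : {poly_m.+1 F} |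
    [&& polyn p \is monic, size (polyn p) == m.+1 & `[< smooth n (polyn p) >]]].

(* The tuples (j_{n+1}, ..., j_m) with 0 <= j_i <= |I_i|: the index k < m - n
   stands for the degree i = n.+1 + k.  The subtraction is truncated, so for
   m <= n the empty tuple is the only element. *)
Definition exponents (F : finFieldType) (n m : nat) : finType :=
  {dffun forall k : 'I_(m - n), 'I_(#|monic_irr F (n.+1 + k)|.+1)}.

(* Main.v *)
Require Import Defs.
From mathcomp Require Import all_boot all_order all_algebra.
From mathcomp Require Import boolp.
Import Order.TTheory GRing.Theory Num.Theory.
Local Open Scope ring_scope.

(* Inclusion-exclusion over the sets J of monic irreducibles of degree in ]n, m]:
   a product P_J of degree d_J has q^(m - d_J) monic multiples of degree m if
   d_J <= m, and none otherwise.  The alternating sum over J is then the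
   coefficient of X^m in
     \prod_(n < i <= m) (1 - X^i)^|I_i| / (1 - q X),
   with the geometric series truncated to a polynomial, and expanding each
   factor by the binomial theorem gives the sum over the tuples j. *)

(** Needed because the range of the exponent [j] depends on the degree. A dependent choice is turned
    into a plain function to the tagged sum of all the [T_ i], to which the non-dependent
    distributivity law applies. *)
Lemma bigA_distr_dffun (R : comPzSemiRingType) (I : finType) (T_ : I -> finType)
    (G : forall i, T_ i -> R) :
  \prod_i \sum_(j : T_ i) G i j =
  \sum_(f : {dffun forall i, T_ i}) \prod_i G i (f i).
Proof.
rewrite (reindex (@dffun_of_fprod I T_)) /=; last first.
  exact: onW_bij (dffun_of_fprod_bij _).
under [RHS]eq_bigr do under eq_bigr => i _ do
  rewrite ffunE -[G i _](ffunE (G i)).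
rewrite (big_fprod 1 (GRing.add : Monoid.add_law 0 *%R) (fun i => finfun (G i))).
(* The default [0] of [untag] is never taken, as [tag x == i] restricts the sum to the fibre over
   [i]. *)
rewrite -(bigA_distr_big_dep (fun i (x : {i : I & T_ i}) => tag x == i)
  (fun i x => untag 0 (finfun (G i)) x)).
apply: eq_bigr => i _; rewrite -(big_tag (fun i => finfun (G i))).
by under [RHS]eq_bigr do rewrite ffunE.
Qed.

Lemma prod_dvdp (F : fieldType) (T : finType) (g : T -> {poly F})
    (J : {set T}) (f : {poly F}) :
    {in J &, forall s t, s != t -> coprimep (g s) (g t)} ->
  (\prod_(t in J) g t %| f) = [forall (t | t \in J), g t %| f].
Proof.
move=> cop; apply/idP/forall_inP => [dvdf t tJ | dvdf].
  by apply: dvdp_trans dvdf; rewrite (bigD1 t) //= dvdp_mulr.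
rewrite -big_enum; have sJ : {subset enum J <= J}.
  by move=> t; rewrite mem_enum.
elim: (enum J) (enum_uniq J) sJ => [|t s IHs] /=; first by rewrite big_nil dvd1p.
move=> /andP[ts us] sJ; rewrite big_cons Gauss_dvdp.
  rewrite dvdf ?sJ ?mem_head //= IHs //.
  by move=> u us'; rewrite sJ // inE us' orbT.
rewrite big_seq; elim/big_ind: _ => [|p r cp cr|u us'].
- exact: coprimep1.
- by rewrite coprimepMr cp.
- apply: cop; rewrite ?sJ ?mem_head // ?inE ?us' ?orbT //.
  by apply: contraNneq ts => ->.
Qed.

(** With [d] the degree of [P] and [d <= m], the multiples are [P * ('X^(m - d) + g)] with [g] of
    size at most [m - d], and [g] is free and determined by the product. *)
Lemma card_monic_multiples (F : finFieldType) (m : nat) (P : {poly F}) :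
    P \is monic ->
  #|[set f : {poly_m.+1 F} | [&& polyn f \is monic, size (polyn f) == m.+1
                               & P %| polyn f]]| =
  (((size P).-1 <= m) * #|F| ^ (m - (size P).-1))%N.
Proof.
move=> monP; have P0 := monic_neq0 monP.
set d := (size P).-1.
have sizeP : size P = d.+1 by rewrite prednK // size_poly_gt0.
have [dm | md] := leqP d m; last first.
  rewrite mul0n; apply/eqP; rewrite cards_eq0 -subset0; apply/subsetP => f.
  rewrite !inE => /and3P[monf /eqP sf /dvdp_leq].
  by rewrite monic_neq0 // sf sizeP ltnS leqNgt md => /(_ isT).
rewrite mul1n -card_npoly.
pose h (g : {poly_(m - d) F}) : {poly_m.+1 F} :=
  npolyp m.+1 (P * ('X^(m - d) + polyn g)).
have size_g (g : {poly_(m - d) F}) : (size (polyn g) < size ('X^(m - d) : {poly F}))%N.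
  by rewrite size_polyXn ltnS size_npoly.
have monXg (g : {poly_(m - d) F}) : 'X^(m - d) + polyn g \is monic.
  by rewrite monicE lead_coefDl ?size_g // lead_coefXn.
have sizeh (g : {poly_(m - d) F}) : size (P * ('X^(m - d) + polyn g)) = m.+1.
  rewrite size_monicM ?monic_neq0 ?monXg // sizeP size_polyDl ?size_g // size_polyXn.
  by rewrite addSn addnS /= subnKC.
have hE g : polyn (h g) = P * ('X^(m - d) + polyn g).
  by rewrite /h npolypK // sizeh.
have h_inj : injective h.
  move=> g1 g2 /(congr1 val); rewrite /= !hE => /(mulfI P0) /addrI.
  exact: val_inj.
rewrite -[RHS](card_imset _ h_inj); apply: eq_card => f; rewrite inE.
apply/and3P/imsetP => [[monf /eqP sf /dvdpP[u fE]] | [g _ ->]]; last first.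
  by rewrite hE sizeh dvdp_mulr // rpredM.
have monu : u \is monic by rewrite -(monicMr u monP) -fE.
have su : size u = (m - d).+1.
  move: sf; rewrite fE mulrC size_monicM ?monic_neq0 // sizeP.
  by rewrite addSn /= -subSn // => <-; rewrite addKn.
(* The cofactor [u] is monic of degree [m - d], so subtracting ['X^(m - d)] cancels its leading
   term; the remainder is the required [g]. *)
have sr : (size (u - 'X^(m - d))%R <= m - d)%N.
  apply/leq_sizeP => j; rewrite leq_eqVlt => /orP[/eqP <- | lt_j].
    rewrite coefB coefXn eqxx; move: monu; rewrite monicE lead_coefE su.
    by move=> /eqP ->; rewrite subrr.
  by rewrite coefB coefXn nth_default ?su // gtn_eqF // subrr.
exists (npolyp (m - d) (u - 'X^(m - d))) => //; apply: val_inj.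
by rewrite /= hE npolypK // addrC subrK fE mulrC.
Qed.

(** Truncating the geometric series after degree [m] is harmless, since only its coefficient at
    [m - d] is read. *)
Lemma coef_scaleXn_geom (R : comNzRingType) (q : R) (m : nat) (c : R) (d : nat) :
  (c *: 'X^d * \poly_(i < m.+1) q ^+ i)`_m = c * ((d <= m)%:R * q ^+ (m - d)).
Proof.
rewrite -scalerAl coefZ coefXnM coef_poly ltnS leq_subr ltnNge.
by case: leqP; rewrite ?mul1r ?mul0r.
Qed.

(** The [g t] are pairwise coprime, so those with [t] in [J] all divide [f] exactly when their
    product does. Each term of the inclusion-exclusion is thus a count of multiples of a single
    monic polynomial. *)
Lemma card_monic_free (F : finFieldType) (m : nat) (T : finType)
    (g : T -> {poly F}) :
    (forall t, g t \is monic) -> (forall t, irreducible_poly (g t)) ->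
    injective g ->
  #|[set f : {poly_m.+1 F} | [&& polyn f \is monic, size (polyn f) == m.+1
       & [forall t, ~~ (g t %| polyn f)]]]|%:R =
  (\prod_t (1 - 'X^((size (g t)).-1)) * \poly_(i < m.+1) #|F|%:R ^+ i)`_m :> rat.
Proof.
move=> mong irrg injg.
pose P (f : {poly_m.+1 F}) := (polyn f \is monic) && (size (polyn f) == m.+1).
pose d (J : {set T}) := (\sum_(t in J) (size (g t)).-1)%N.
have monJ (J : {set T}) : \prod_(t in J) g t \is monic by apply: monic_prod.
have sizeJ (J : {set T}) : (size (\prod_(t in J) g t)%R).-1 = d J.
  rewrite size_prod => [|t _]; last exact: monic_neq0.
  rewrite subSn; last first.
    by rewrite -sum1_card leq_sum // => t _; rewrite size_poly_gt0 monic_neq0.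
  rewrite /= -sum1_card -sumnB // => [|t _]; last by rewrite size_poly_gt0 monic_neq0.
  by apply: eq_bigr => t _; rewrite subn1.
have copg : {in predT &, forall s t, s != t -> coprimep (g s) (g t)}.
  move=> s t _ _ st; rewrite irreducible_poly_coprime //.
  apply: contraNN st => dvd; apply/eqP/injg/eqP; rewrite -eqp_monic //.
  by apply: (apply_irredp (irrg t)) => //; case: (irrg s) => /gtn_eqF->.
have -> : \prod_t (1 - 'X^((size (g t)).-1)) =
    \sum_(J in {set T}) (-1) ^+ #|J| *: 'X^(d J) :> {poly rat}.
  under eq_bigr do rewrite addrC.
  rewrite bigA_distr; apply: eq_bigr => J _; rewrite big_if /= [X in _ * X]big1_eq mulr1.
  rewrite prodrN prodrXr.
  by rewrite -[RHS]mul_polyC rmorphXn rmorphN1.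
(* The indicator of being divisible by no [g t] is a product of factors [1 - [g t divides f]], which
   will be expanded over subsets. *)
have -> : #|[set f : {poly_m.+1 F} | [&& polyn f \is monic,
     size (polyn f) == m.+1 & [forall t, ~~ (g t %| polyn f)]]]|%:R =
   \sum_(f | P f) \prod_t (- (g t %| polyn f)%R%:R + 1) :> rat.
  rewrite -sum1_card natr_sum [RHS]big_mkcond [LHS]big_mkcond /=.
  apply: eq_bigr => f _; rewrite inE /P andbA.
  case: ifP => [/andP[-> /forallP free] | ]; first last.
    case: ifP => // _ /negbT; rewrite negb_forall => /existsP[t].
    by rewrite negbK (bigD1 t) //= => ->; rewrite addNr mul0r.
  by rewrite big1 // => t _; rewrite (negPf (free t)) oppr0 add0r.
rewrite mulr_suml coef_sum.
under eq_bigr do rewrite bigA_distr.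
(* Both sides now agree subset by subset: each is [(-1) ^+ #|J|] times the number of monic multiples
   of the product over [J]. *)
rewrite exchange_big /=; apply: eq_bigr => J _.
rewrite coef_scaleXn_geom -sizeJ -natrX -natrM -card_monic_multiples //.
rewrite -[#|finset _|]sum1_card natr_sum mulr_sumr [RHS]big_mkcond [LHS]big_mkcond /=.
apply: eq_bigr => f _; rewrite inE andbA -/(P f); case: (P f) => //=.
rewrite big_if /= [X in _ * X]big1_eq mulr1 prodrN prod_dvdp => [|s t _ _]; last first.
  exact: copg.
case: ifP => [/forall_inP dvdf | /negbT].
  by rewrite mulr1 big1 ?mulr1 // => t /dvdf ->.
rewrite negb_forall_in => /exists_inP[t tJ ndvd].
by rewrite (bigD1 t) //= (negPf ndvd) mul0r mulr0.
Qed.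

Lemma expr_1subXn (R : comNzRingType) (d N : nat) :
  (1 - 'X^d) ^+ N =
  \sum_(j < N.+1) ((-1) ^+ j * 'C(N, j)%:R) *: 'X^(d * j) :> {poly R}.
Proof.
rewrite exprDn; apply: eq_bigr => j _.
rewrite expr1n mul1r [(- 'X^d) ^+ j]exprNn -exprM -mulr_natr -mul_polyC.
by rewrite rmorphM rmorphXn rmorphN1 rmorph_nat mulrAC.
Qed.

(** An irreducible factor violating smoothness has degree in ]n, m] because [f] has degree [m], and
    scaling it to be monic preserves divisibility. So finitely many tests suffice. *)
Lemma smoothP (F : finFieldType) (n m : nat) (f : {poly F}) :
    size f = m.+1 ->
  reflect (forall (k : 'I_(m - n)) (p : {poly_(n.+1 + k).+1 F}),
             p \in monic_irr F (n.+1 + k) -> ~~ (polyn p %| f))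
          `[< smooth n f >].
Proof.
move=> sf; have f0 : f != 0 by rewrite -size_poly_gt0 sf.
apply: (iffP (asboolP _)) => [smf k p | free h irrh hf].
  rewrite inE => /and3P[_ /eqP sp /irreducibleP irrp]; apply/negP => pf.
  by have := smf _ irrp pf; rewrite sp ltnS addSn ltnNge leq_addr.
rewrite leqNgt; apply/negP => lt_nh.
have sh : (size h <= m.+1)%N by rewrite -sf dvdp_leq.
have le_nh : (n.+1 <= (size h).-1)%N by rewrite -ltnS (ltn_predK lt_nh).
have lt_k : ((size h).-1 - n.+1 < m - n)%N.
  by rewrite -subSn // subSS leq_sub2r // -ltnS (ltn_predK lt_nh).
pose k := Ordinal lt_k.
have size_k : size h = (n.+1 + k).+1 by rewrite subnKC // (ltn_predK lt_nh).
have lch : (lead_coef h)^-1 != 0 by rewrite invr_eq0 lead_coef_eq0 irredp_neq0.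
pose h1 := (lead_coef h)^-1 *: h.
have eqh : h1 %= h by rewrite eqp_scale.
have sh1 : size h1 = (n.+1 + k).+1 by rewrite (eqp_size eqh).
have h1E : polyn (npolyp (n.+1 + k).+1 h1) = h1 by rewrite npolypK ?sh1.
have := free k (npolyp _ h1); rewrite h1E (eqp_dvdl _ eqh) hf.
suff -> : npolyp _ h1 \in monic_irr F (n.+1 + k) by move=> /(_ isT).
rewrite inE h1E sh1 eqxx /= monicE lead_coefZ mulVf ?eqxx -1?invr_eq0 //=.
apply/irreducibleP; split=> [|p sp ph1]; first by rewrite sh1.
by rewrite (eqp_rtrans eqh) (irrh.2 p) // -(eqp_dvdr _ eqh).
Qed.

Theorem corollary10 (F : finFieldType) (q : nat) (hq : #|F| = q)
    (m n : nat) (hm : (1 <= m)%N) (hn : (1 <= n)%N) :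
  #|monic_smooth F n m|%:R =
  q%:R ^+ m *
  \sum_(j : exponents F n m)
     ((\sum_(k < m - n) (n.+1 + k) * j k <= m)%N : bool)%:R *
     \prod_(k < m - n)
        (q%:R ^- ((n.+1 + k) * j k) *
         'C(#|monic_irr F (n.+1 + k)|, j k)%:R *
         (-1) ^+ (j k)) :> rat.
Proof.
have q0 : q%:R != 0 :> rat.
  by rewrite -hq pnatr_eq0 -lt0n; apply/card_gt0P; exists 0.
(* [T] is the disjoint union of the sets of monic irreducibles of degree in ]n, m]; the map [g]
   forgets the degree, which the size of the polynomial recovers. *)
pose T_ (k : 'I_(m - n)) : finType := {p | p \in monic_irr F (n.+1 + k)}.
pose T : finType := {k : 'I_(m - n) & T_ k}.
pose g (t : T) : {poly F} := polyn (val (tagged t)).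
have gP (t : T) : [/\ g t \is monic, size (g t) = (n.+1 + tag t).+1
                    & irreducible_poly (g t)].
  case: t => k [p pI]; rewrite /g /=; move: pI; rewrite inE.
  by case/and3P => ? /eqP ? /irreducibleP.
have g_inj : injective g.
  move=> s t gst; have : tag s = tag t.
    apply/val_inj/eqP; rewrite -(eqn_add2l n.+1) -eqSS.
    by have [_ <- _] := gP s; have [_ <- _] := gP t; rewrite gst.
  case: s t gst => k s [l t] /= + kl; case: l / kl t => t gst.
  by congr Tagged; do 2!apply: val_inj.
have -> : monic_smooth F n m = [set f : {poly_m.+1 F} | [&& polyn f \is monic,
    size (polyn f) == m.+1 & [forall t, ~~ (g t %| polyn f)]]].
  apply/setP => f; rewrite !inE; congr (_ && _); apply: andb_id2l => /eqP sf.
  apply/(smoothP _ _ _ _ sf)/forallP => [free [k [p pI]] | free k p pI].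
    exact: free.
  exact: (free (Tagged T_ (exist _ p pI))).
rewrite card_monic_free // => [|t|t]; try by case: (gP t).
rewrite hq.
have -> : \prod_t (1 - 'X^((size (g t)).-1)) =
    \sum_(j : exponents F n m) (\prod_(k < m - n) ((-1) ^+ j k *
       'C(#|monic_irr F (n.+1 + k)|, j k)%:R)) *:
       'X^(\sum_(k < m - n) (n.+1 + k) * j k)%N :> {poly rat}.
  (* Grouping by degree gives one power [(1 - 'X^i) ^+ #|I_i|] per degree [i], ready for the
     binomial theorem. *)
  transitivity (\prod_(k < m - n) \prod_(p : T_ k) (1 - 'X^(n.+1 + k)) : {poly rat}).
    rewrite (sig_big_dep predT (fun=> predT) (fun (k : 'I_(m - n)) _ => 1 - 'X^(n.+1 + k))) /=.
    by apply: eq_bigr => t _; have [_ -> _] := gP t.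
  under eq_bigr do rewrite prodr_const card_sig expr_1subXn.
  rewrite bigA_distr_dffun; apply: eq_bigr => j _.
  by rewrite scaler_prod prodrXr.
rewrite mulr_suml coef_sum mulr_sumr; apply: eq_bigr => j _.
rewrite coef_scaleXn_geom mulrCA [RHS]mulrCA.
(* Tuples of weight above [m] contribute zero on both sides. For the others the truncated exponent
   is a true difference, so the power of [q] splits as a quotient. *)
case: leqP => [le_m | _]; last by rewrite !mul0r.
rewrite !mul1r expfB_cond; last by rewrite (negPf q0).
rewrite expr_sum -prodfV mulrCA -big_split /=; congr (_ * _).
by apply: eq_bigr => k _; rewrite mulrC mulrA mulrAC.
Qed.
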